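(* Let $p>3$ be a prime, and let $(a_k)_{k\ge 0}$ be any sequence of $p$-adic integers, with dual sequence $(a_k^* )_{k\ge0}$. Then $$\sum_{k=0}^{p-1}\binom{2k}{k}\frac{a_k^*}{4^k}\equiv\frac{p}{4^{p-1}}\sum_{k=0}^{p-1}\frac{a_k}{2k+1}-p\,H_{\frac{p-1}{2}}\,a_{\frac{p-1}{2}}\pmod{p^2}.$$
   Context: The dual sequence of $(a_n)_{n\ge0}$ is $a_n^*:=\sum_{k=0}^n\binom{n}{k}(-1)^k a_k$. $H_k=\sum_{i=1}^k 1/i$ is the $k$-th harmonic number, with $H_0=0$. Congruences modulo $p^2$ are in the ring $\mathbb{Z}_p$ of $p$-adic integers (the factor $p$ multiplying the sum on the right makes each term $p\,a_k/(2k+1)$ a $p$-adic integer). *)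

(* Defs.v *)
From HB Require Import structures.
From mathcomp Require Import all_boot all_order all_algebra.
From mathcomp Require Import fraction boolp.

Set Implicit Arguments.
Unset Strict Implicit.
Unset Printing Implicit Defensive.

Import GRing.Theory Num.Theory.
Local Open Scope ring_scope.

(* Z_p as the inverse limit of the rings Z/p^n.  An element is the sequence of
   its residues modulo p^n; [approxP] forces the n-th residue to be the
   canonical representative in [0, p^n), so Leibniz equality of sequences is
   equality of p-adic integers. *)
Record padic_int (p : nat) (p_pr : prime p) := PadicInt {
  approx : nat -> int;
  approxP : forall n, (approx n.+1 %% (p%:Z ^+ n))%Z = approx n
}.

Section PadicInt.
Variables (p : nat) (p_pr : prime p).
Local Notation Zp := (padic_int p_pr).
Local Notation q n := (p%:Z ^+ n).

Lemma padic_ext (x y : Zp) : (forall n, approx x n = approx y n) -> x = y.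
Proof.
case: x y => [x xP] [y yP] /= exy.
have {}exy : x = y by apply: funext.
by case: y / exy yP => yP; congr PadicInt; apply: Prop_irrelevance.
Qed.

HB.instance Definition _ := gen_eqMixin Zp.
HB.instance Definition _ := gen_choiceMixin Zp.

Lemma padic_q_neq0 n : q n != 0.
Proof. by rewrite expf_neq0 // eqz_nat -lt0n prime_gt0. Qed.

Lemma approx_mod (x : Zp) n : (approx x n %% q n)%Z = approx x n.
Proof. by rewrite -(approxP x n) modz_mod. Qed.

Lemma modz_dvdm (m d e : int) : (d %| e)%Z -> ((m %% e)%Z %% d)%Z = (m %% d)%Z.
Proof.
by case/dvdzP=> c ->; rewrite [in RHS](divz_eq m (c * d)) mulrA modzMDl.
Qed.

Lemma modz_down (m : int) n : ((m %% q n.+1)%Z %% q n)%Z = (m %% q n)%Z.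
Proof. by rewrite modz_dvdm // exprS dvdz_mull. Qed.

Lemma padic_subproof (f : nat -> int) :
    (forall n, (f n.+1 = f n %[mod q n])%Z) ->
  forall n, ((f n.+1 %% q n.+1)%Z %% q n)%Z = (f n %% q n)%Z.
Proof. by move=> fP n; rewrite modz_down fP. Qed.

Definition mk_padic f fP : Zp :=
  PadicInt p_pr (@padic_subproof f fP).

Lemma padic_const_compat (m : int) n : (m = m %[mod q n])%Z.
Proof. by []. Qed.

Lemma padic_opp_compat (x : Zp) n :
  (- approx x n.+1 = - approx x n %[mod q n])%Z.
Proof. by rewrite -(approxP x n) modzNm. Qed.

Lemma padic_add_compat (x y : Zp) n :
  (approx x n.+1 + approx y n.+1 = approx x n + approx y n %[mod q n])%Z.
Proof. by rewrite -(approxP x n) -(approxP y n) modzDm. Qed.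

Lemma padic_mul_compat (x y : Zp) n :
  (approx x n.+1 * approx y n.+1 = approx x n * approx y n %[mod q n])%Z.
Proof. by rewrite -(approxP x n) -(approxP y n) modzMm. Qed.

Definition padic_of_int (m : int) : Zp := mk_padic (padic_const_compat m).
Definition padic_opp x : Zp := mk_padic (padic_opp_compat x).
Definition padic_add x y : Zp := mk_padic (padic_add_compat x y).
Definition padic_mul x y : Zp := mk_padic (padic_mul_compat x y).

Lemma padic_addA : associative padic_add.
Proof. by move=> x y z; apply: padic_ext => n /=; rewrite modzDml modzDmr addrA. Qed.

Lemma padic_addC : commutative padic_add.
Proof. by move=> x y; apply: padic_ext => n /=; rewrite addrC. Qed.

Lemma padic_add0 : left_id (padic_of_int 0) padic_add.
Proof. by move=> x; apply: padic_ext => n /=; rewrite modzDml add0r approx_mod. Qed.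

Lemma padic_addN : left_inverse (padic_of_int 0) padic_opp padic_add.
Proof. by move=> x; apply: padic_ext => n /=; rewrite modzDml addNr. Qed.

HB.instance Definition _ := GRing.isZmodule.Build Zp
  padic_addA padic_addC padic_add0 padic_addN.

Lemma padic_mulA : associative padic_mul.
Proof. by move=> x y z; apply: padic_ext => n /=; rewrite modzMml modzMmr mulrA. Qed.

Lemma padic_mulC : commutative padic_mul.
Proof. by move=> x y; apply: padic_ext => n /=; rewrite mulrC. Qed.

Lemma padic_mul1 : left_id (padic_of_int 1) padic_mul.
Proof. by move=> x; apply: padic_ext => n /=; rewrite modzMml mul1r approx_mod. Qed.

Lemma padic_mulD : left_distributive padic_mul (@padic_add).
Proof.
by move=> x y z; apply: padic_ext => n /=; rewrite modzMml modzDm mulrDl.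
Qed.

Lemma modz_p1 : (1 %% p%:Z)%Z = 1.
Proof. by rewrite modz_nat modn_small // prime_gt1. Qed.

Lemma padic_1neq0 : padic_of_int 1 != 0.
Proof. by apply/eqP => /(congr1 (fun x : Zp => approx x 1)) /=; rewrite expr1 modz_p1 mod0z. Qed.

HB.instance Definition _ := GRing.Zmodule_isComNzRing.Build Zp
  padic_mulA padic_mulC padic_mul1 padic_mulD padic_1neq0.

Definition padic_unit : pred Zp := fun x => approx x 1 != 0.

Lemma approx_residue (x : Zp) n : (approx x n.+1 %% p)%Z = approx x 1.
Proof.
elim: n => [|n IHn]; first by rewrite -{1}[p%:Z]expr1 approx_mod.
by rewrite -IHn -[in RHS](approxP x n.+1) modz_dvdm // exprSr dvdz_mull.
Qed.

Definition padic_inv_seq (x : Zp) n : int := (egcdz (approx x n) (q n)).1.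

Lemma padic_inv_seqP (x : Zp) n : padic_unit x ->
  (padic_inv_seq x n * approx x n = 1 %[mod q n])%Z.
Proof.
move=> xU; case: n => [|n]; first by rewrite expr0 !modz1.
rewrite /padic_inv_seq; case: egcdzP => u v /= uv _.
have cop : coprimez (approx x n.+1) (q n.+1).
  rewrite coprimezXr // coprimez_sym coprimezE absz_nat prime_coprime //.
  by apply: contra xU => pa; rewrite -(approx_residue x n); apply/eqP/dvdz_mod0P.
apply/eqP; rewrite eqz_mod_dvd -(eqP cop) -uv opprD addrA subrr add0r.
by rewrite -mulNr dvdz_mull.
Qed.

Lemma padic_inv_compat (x : Zp) (xU : padic_unit x) n :
  (padic_inv_seq x n.+1 = padic_inv_seq x n %[mod q n])%Z.
Proof.
set u := padic_inv_seq x n.+1; set v := padic_inv_seq x n.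
have uP : (u * approx x n = 1 %[mod q n])%Z.
  rewrite -(approxP x n) modzMmr -modz_down (padic_inv_seqP n.+1 xU).
  by rewrite modz_down.
have vP : (v * approx x n = 1 %[mod q n])%Z by apply: padic_inv_seqP.
rewrite -[LHS]mulr1 -[u in LHS]mulr1 -modzMmr -vP modzMmr mulrCA mulr1.
by rewrite -modzMmr uP modzMmr !mulr1.
Qed.

Definition padic_inv (x : Zp) : Zp :=
  match @idP (padic_unit x) with
  | ReflectT xU => mk_padic (padic_inv_compat xU)
  | ReflectF _ => x
  end.

Lemma padic_mulV : {in padic_unit, left_inverse 1 padic_inv *%R}.
Proof.
move=> x; rewrite unfold_in => xU; apply: padic_ext => n.
rewrite /padic_inv; case: {-}_ / idP => // xU' /=.
by rewrite modzMml padic_inv_seqP.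
Qed.

Lemma padic_unitP (x y : Zp) : y * x = 1 -> padic_unit x.
Proof.
move=> /(congr1 (fun z : Zp => approx z 1)) /=; rewrite expr1 modz_p1 => yx.
by apply/eqP => x0; move: yx; rewrite x0 mulr0 mod0z.
Qed.

Lemma padic_inv_out : {in [predC padic_unit], padic_inv =1 id}.
Proof.
by move=> x /negP xN; rewrite /padic_inv; case: {-}_ / idP => // /xN.
Qed.

HB.instance Definition _ := GRing.ComNzRing_hasMulInverse.Build Zp
  padic_mulV padic_unitP padic_inv_out.

Lemma approx_dvd (x : Zp) m k :
  ((q m %| approx x (m + k)%N) = (approx x m == 0))%Z.
Proof.
suff -> : approx x m = (approx x (m + k) %% q m)%Z by apply/dvdz_mod0P/eqP.
elim: k => [|k IHk]; first by rewrite addn0 approx_mod.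
by rewrite IHk -(approxP x (m + k)) addnS modz_dvdm // exprD dvdz_mulr.
Qed.

Lemma padic_neq0P (x : Zp) : x != 0 -> exists n, approx x n != 0.
Proof.
move=> x0; apply: contrapT => /forallNP x_eq0; case/eqP: x0.
by apply: padic_ext => n /=; rewrite mod0z; apply/eqP/negPn/negP.
Qed.

Lemma padic_integral (x y : Zp) : x * y = 0 -> (x == 0) || (y == 0).
Proof.
move=> xy0; apply/norP => -[/padic_neq0P[m xm] /padic_neq0P[n yn]].
move: xm yn; rewrite -(approx_dvd x m n) -(approx_dvd y n m) [(n + m)%N]addnC.
move: xy0 => /(congr1 (fun z : Zp => approx z (m + n)%N)) /=.
rewrite mod0z => /dvdz_mod0P.
move: (approx x _) (approx y _) => a b.
rewrite !dvdzE !abszX absz_nat abszM.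
move: `|a|%N `|b|%N => {}a {}b ab am bn.
have a_gt0 : (0 < a)%N by rewrite lt0n; apply: contraNneq am => ->; rewrite dvdn0.
have b_gt0 : (0 < b)%N by rewrite lt0n; apply: contraNneq bn => ->; rewrite dvdn0.
move: ab am bn; rewrite !pfactor_dvdn ?muln_gt0 ?a_gt0 // lognM // -!ltnNge.
by move=> le_mn lt_m lt_n; move: (leq_add lt_m (ltnW lt_n)); rewrite addSn ltnNge le_mn.
Qed.

HB.instance Definition _ :=
  GRing.ComUnitRing_isIntegral.Build Zp padic_integral.

End PadicInt.

Notation padic p_pr := {fraction (padic_int p_pr)}.
Notation "x %:F" := (@FracField.tofrac _ x) : ring_scope.

(* x and y are given in Q_p; the congruence is in Z_p, so it includes the fact
   that both of them lie in Z_p. *)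
Definition padic_congr (p : nat) (p_pr : prime p) (m : nat)
    (x y : padic p_pr) : Prop :=
  exists u v w : padic_int p_pr,
    [/\ x = u%:F, y = v%:F
      & u - v = p%:R ^+ m * w].

Definition dual_seq (R : pzRingType) (a : nat -> R) (n : nat) : R :=
  \sum_(0 <= k < n.+1) 'C(n, k)%:R * (-1) ^+ k * a k.

Definition harmonic_number (F : fieldType) (k : nat) : F :=
  \sum_(1 <= i < k.+1) i%:R^-1.

(* Main.v *)
Require Import Defs.
From mathcomp Require Import all_boot all_order all_algebra fraction.
From mathcomp Require Import ring zify.
Import GRing.Theory.
Local Open Scope ring_scope.

(** Write the dual sequence out and exchange the two summations: the
    coefficient of a_k on the left-hand side is (-1)^k times
    S_k = sum_(m < p) C(m,k) C(2m,m) / 4^m.  This sum telescopes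
    ([sum_bin_central_bin]), and after rewriting (2p-1) C(2p-2,p-1) as
    p C(2p-1,p-1) the left-hand side is, exactly,
      4^-(p-1) C(2p-1,p-1) sum_(k < p) (-1)^k C(p-1,k) (p / (2k+1)) a_k
    ([sum_central_bin_dual], valid with any n > 0 in place of p).

    It remains to reduce each factor.  Both binomials are products,
      (-1)^k C(p-1,k) = prod_(1 <= i <= k) (1 - p/i),
      C(2p-1,p-1) = prod_(1 <= i < p) (1 + p/i),
    which modulo p^2 become 1 - p H_k and 1 + p H_(p-1); the latter is 1
    because pairing i with p - i shows that p divides H_(p-1).  For
    k <> (p-1)/2 the factor p/(2k+1) is a multiple of p, so it is enough that
    both binomial factors are 1 modulo p.  For k = (p-1)/2 the factor p/(2k+1)
    is 1 and the correction - p H_k survives; Fermat's 4^(p-1) = 1 mod p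
    removes the power of 4 in front of it ([summand_mod_sqr]).

    The congruences are proved in any commutative ring in which the integers
    prime to p are invertible, as explicit equations x = y + p^2 w.  The
    division by 2k+1, not always possible in such a ring, is needed only in
    the exact identity, which lives in a field of characteristic 0. *)

(** * The exact identity *)

Lemma central_bin_rec {F : fieldType} (n : nat) :
  [pchar F] =i pred0 ->
  2%:R * n.+1%:R * ('C(2 * n.+1, n.+1)%:R / 4%:R ^+ n.+1)
    = (2 * n + 1)%:R * ('C(2 * n, n)%:R / 4%:R ^+ n) :> F.
Proof.
move=> /pcharf0P char0.
have step : (n.+1 * 'C(2 * n.+1, n.+1) = 2 * (2 * n + 1) * 'C(2 * n, n))%N.
  have e1 : ('C(2 * n + 1, n.+1) = 'C(2 * n + 1, n))%N.
    by rewrite -bin_sub; [congr binomial; lia | lia].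
  have e2 := mul_bin_diag (2 * n.+1) n.
  have e3 := mul_bin_diag (2 * n + 1) n.
  rewrite (_ : (2 * n.+1).-1 = 2 * n + 1)%N in e2; last lia.
  rewrite (_ : (2 * n + 1).-1 = 2 * n)%N in e3; last lia.
  by rewrite -e2 -e1 -!mulnA e3.
have four0 : 4%:R != 0 :> F by rewrite char0.
have {}step := congr1 (fun m : nat => m%:R : F) step.
rewrite /= 2!natrM [(2 * _)%:R]natrM in step.
rewrite -mulrA [n.+1%:R * _]mulrA step exprS.
by field; rewrite four0 expf_neq0.
Qed.

(** The right-hand side, as a function of n, has the summand times 2k+1 as its
    difference: by [central_bin_rec] its values at n and n+1 are both
    multiples of C(2n+2,n+1) / 4^(n+1), and (n+1) C(n,k) = (n+1-k) C(n+1,k). *)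
Lemma sum_bin_central_bin {F : fieldType} (k n : nat) :
  [pchar F] =i pred0 ->
  (2 * k + 1)%:R
    * (\sum_(0 <= m < n.+1) 'C(m, k)%:R * ('C(2 * m, m)%:R / 4%:R ^+ m))
    = (2 * n + 1)%:R * 'C(n, k)%:R * ('C(2 * n, n)%:R / 4%:R ^+ n) :> F.
Proof.
move=> char0; elim: n => [|n IHn].
  rewrite big_nat1 bin0n; case: k => [|k] /=; last by rewrite !(mul0r, mulr0).
  by ring.
rewrite big_nat_recr //= mulrDr IHn.
rewrite mulrAC -(central_bin_rec _ char0).
set t := _ / 4%:R ^+ n.+1.
have down : (n.+1%:R * 'C(n, k)%:R = (n.+1%:R - k%:R) * 'C(n.+1, k)%:R :> F).
  case: (leqP k n.+1) => kn; last by rewrite !bin_small ?mulr0 //; lia.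
  by rewrite -natrB // -!natrM (mul_bin_down n.+1).
rewrite (_ : _ * t * _ = 2%:R * t * (n.+1%:R * 'C(n, k)%:R)); last by ring.
rewrite down !natrD !natrM; ring.
Qed.

Lemma sum_central_bin_dual {F : fieldType} (n : nat) (a : nat -> F) :
  (0 < n)%N -> [pchar F] =i pred0 ->
  \sum_(0 <= k < n) 'C(2 * k, k)%:R * dual_seq a k / 4%:R ^+ k
  = (4%:R^-1) ^+ (n - 1) *
    \sum_(0 <= k < n) 'C(2 * n - 1, n - 1)%:R * ((-1) ^+ k * 'C(n - 1, k)%:R)
       * (n%:R / (2 * k + 1)%:R * a k).
Proof.
move=> n0 char0.
transitivity (\sum_(0 <= m < n) \sum_(0 <= k < n)
    (-1) ^+ k * a k * ('C(m, k)%:R * ('C(2 * m, m)%:R / 4%:R ^+ m))).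
  (* C(m,k) = 0 for k > m, so the inner sums may all run up to n. *)
  apply: eq_big_nat => m /andP[_ mn].
  rewrite /dual_seq (@big_cat_nat _ _ _ m.+1 0 n) //=.
  rewrite [X in _ = _ + X]big_nat [X in _ = _ + X]big1 ?addr0; last first.
    move=> k /andP[mk _].
    by rewrite bin_small // mul0r mulr0.
  rewrite mulr_sumr mulr_suml; apply: eq_bigr => k _; ring.
rewrite exchange_big_nat mulr_sumr /=; apply: eq_bigr => k _.
have k0 : (2 * k + 1)%:R != 0 :> F by move/pcharf0P: char0 => ->; rewrite addn1.
rewrite -mulr_sumr.
apply: (mulfI k0).
have := sum_bin_central_bin k (n - 1) char0.
rewrite (_ : (n - 1).+1 = n); last by lia.
move=> sumE; rewrite mulrCA sumE.
have diag : ((2 * (n - 1) + 1) * 'C(2 * (n - 1), n - 1)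
             = n * 'C(2 * n - 1, n - 1))%N.
  have e1 : 'C(2 * n - 1, n - 1) = 'C(2 * n - 1, n).
    by rewrite -bin_sub; [congr binomial; lia | lia].
  have := mul_bin_diag (2 * n - 1) (n - 1).
  rewrite e1 (_ : (n - 1).+1 = n) //; last by lia.
  by move=> <-; congr (_ * 'C(_, _))%N; lia.
have {}diag := congr1 (fun m : nat => m%:R : F) diag.
rewrite /= 2!natrM in diag.
rewrite exprVn.
transitivity ((-1) ^+ k * a k * 'C(n - 1, k)%:R / 4%:R ^+ (n - 1)
   * ((2 * (n - 1) + 1)%:R * 'C(2 * (n - 1), n - 1)%:R)); first by ring.
rewrite diag; move: ((2 * k + 1)%:R) k0 => d d0; field.
by rewrite d0 expf_neq0 //; move/pcharf0P: char0 => ->.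
Qed.

(** * Congruences modulo the square of a prime *)

Lemma prod_1D_mod_sqr {R : comPzRingType} (x : R) (f : nat -> R) (m n : nat) :
  exists w, \prod_(m <= i < n) (1 + x * f i)
            = 1 + x * \sum_(m <= i < n) f i + x ^+ 2 * w.
Proof.
elim/big_rec2: _ => [|i s y _ [w ->]]; first by exists 0; ring.
by exists (f i * s + w + x * f i * w); ring.
Qed.

Lemma sign_bin_prod {R : comUnitRingType} (n k : nat) :
  (k <= n)%N -> (forall i, (0 < i <= k)%N -> i%:R \is a @GRing.unit R) ->
  (-1) ^+ k * 'C(n, k)%:R = \prod_(1 <= i < k.+1) (1 - n.+1%:R / i%:R) :> R.
Proof.
elim: k => [|k IHk] kn ku; first by rewrite big_geq // bin0 mulr1.
have uk : k.+1%:R \is a @GRing.unit R by apply: ku; lia.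
rewrite big_nat_recr //= -IHk; try (move=> *; try apply: ku; lia).
have := congr1 (fun m : nat => m%:R : R) (mul_bin_left n k).
rewrite /= !natrM natrB; last lia.
move=> /(canRL (mulKr uk)) ->.
have -> : 1 - n.+1%:R / k.+1%:R = (k%:R - n%:R) / k.+1%:R :> R.
  by rewrite -{1}(mulrV uk) -mulrBl; congr (_ / _); ring.
by rewrite exprS; ring.
Qed.

Lemma bin_addn_prod {R : comUnitRingType} (n k : nat) :
  (forall i, (0 < i <= k)%N -> i%:R \is a @GRing.unit R) ->
  'C(n + k, k)%:R = \prod_(1 <= i < k.+1) (1 + n%:R / i%:R) :> R.
Proof.
elim: k => [|k IHk] ku; first by rewrite big_geq // bin0.
have uk : k.+1%:R \is a @GRing.unit R by apply: ku; lia.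
rewrite big_nat_recr //= -IHk; last by move=> *; apply: ku; lia.
have := congr1 (fun m : nat => m%:R : R) (mul_bin_diag (n + k.+1) k).
rewrite addnS /= -addnS !natrM => /esym /(canRL (mulKr uk)) ->.
rewrite natrD mulrDl mulrDr mulKr //; ring.
Qed.

Lemma odd_prime_ndvd4 (p : nat) : prime p -> (2 < p)%N -> ~~ (p %| 4)%N.
Proof.
move=> p_pr p2; rewrite (_ : 4 = 2 ^ 2)%N //.
by rewrite Euclid_dvdX // andbT dvdn_prime2 // gtn_eqF.
Qed.

Section PrimeUnits.
(* The hypothesis on units says that R is an algebra over the localization of
   the integers at p. *)
Variables (R : comUnitRingType) (p : nat).
Hypothesis p_pr : prime p.
Hypothesis coprime_unit : forall n, ~~ (p %| n)%N -> n%:R \is a @GRing.unit R.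

Lemma unit_lt_prime (i : nat) : (0 < i < p)%N -> i%:R \is a @GRing.unit R.
Proof. by case/andP=> i0 ip; apply: coprime_unit; rewrite gtnNdvd. Qed.

(** Pair i with p - i: 1/i + 1/(p-i) = p / (i (p-i)), so p divides twice the
    sum, and 2 is a unit. *)
Lemma harmonic_mod_prime : (2 < p)%N ->
  exists w, \sum_(1 <= i < p) i%:R^-1 = p%:R * w :> R.
Proof.
move=> p2; have u2 : 2%:R \is a @GRing.unit R by apply: unit_lt_prime.
exists (2%:R^-1 * \sum_(1 <= i < p) i%:R^-1 * (p - i)%:R^-1).
rewrite mulrCA; apply: (canRL (mulKr u2)).
rewrite mulr_natl mulr2n {2}big_nat_rev /= -big_split mulr_sumr /=.
rewrite !big_nat; apply: eq_bigr => i /andP[i0 ip].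
rewrite (_ : 1 + p - i.+1 = p - i)%N; last lia.
have ui : i%:R \is a @GRing.unit R by apply: unit_lt_prime; lia.
have upi : (p - i)%:R \is a @GRing.unit R by apply: unit_lt_prime; lia.
have -> : p%:R = i%:R + (p - i)%:R :> R by rewrite -natrD subnKC // ltnW.
by rewrite mulrDl mulVKr // mulrCA mulrV // mulr1 addrC.
Qed.

(** Babbage's congruence: the linear term of prod (1 + p/i) is p H_(p-1),
    itself a multiple of p^2. *)
Lemma bin_double_prime_mod_sqr : (2 < p)%N ->
  exists w, 'C(2 * p - 1, p - 1)%:R = 1 + p%:R ^+ 2 * w :> R.
Proof.
move=> p2; have [h hE] := harmonic_mod_prime p2.
have [w wE] := prod_1D_mod_sqr (p%:R : R) (fun i => i%:R^-1) 1 (p - 1).+1.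
exists (h + w).
rewrite (_ : 2 * p - 1 = p + (p - 1))%N; last lia.
rewrite bin_addn_prod; last by move=> *; apply: unit_lt_prime; lia.
by rewrite wE (_ : (p - 1).+1 = p) ?hE; [ring | lia].
Qed.

Lemma sign_bin_prime_mod_sqr (k : nat) : (k < p)%N ->
  exists w, (-1) ^+ k * 'C(p - 1, k)%:R
    = 1 - p%:R * \sum_(1 <= i < k.+1) i%:R^-1 + p%:R ^+ 2 * w :> R.
Proof.
move=> kp.
have [w wE] := prod_1D_mod_sqr (- p%:R : R) (fun i => i%:R^-1) 1 k.+1.
exists w; rewrite -mulNr -[p%:R ^+ 2]sqrrN -wE sign_bin_prod; last 2 first.
- by lia.
- by move=> *; apply: unit_lt_prime; lia.
by apply: eq_bigr => i _; rewrite (_ : (p - 1).+1 = p) ?mulNr //; lia.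
Qed.

Lemma fermat_inv_mod_prime (n : nat) : ~~ (p %| n)%N ->
  exists w, (n%:R^-1) ^+ (p - 1) = 1 + p%:R * w :> R.
Proof.
move=> pn; have un := coprime_unit n pn.
have p0 := prime_gt0 p_pr.
have n0 : (0 < n)%N by rewrite lt0n; apply: contraNneq pn => ->; rewrite dvdn0.
have : (p %| n ^ (p - 1) - 1)%N.
  rewrite -eqn_mod_dvd ?expn_gt0 ?n0 //.
  have := fermat_little n p_pr; rewrite -{1}(subnK p0) expnD expn1 => /eqP.
  rewrite eqn_mod_dvd ?leq_pmull ?expn_gt0 ?n0 //.
  rewrite -{3}[n]mul1n -mulnBl Euclid_dvdM // (negPf pn) orbF.
  by rewrite eqn_mod_dvd ?expn_gt0 ?n0.
case/dvdnP=> c cE; exists (- c%:R * (n%:R^-1) ^+ (p - 1)).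
have nE : n%:R ^+ (p - 1) = 1 + p%:R * c%:R :> R.
  by rewrite -natrX -natrM mulnC -cE -[1]/(1%:R) -natrD subnKC // expn_gt0 n0.
apply: (mulrI (unitrX (p - 1) un)).
have nV : n%:R ^+ (p - 1) * n%:R^-1 ^+ (p - 1) = 1 :> R.
  by rewrite exprVn mulrV ?unitrX.
transitivity (n%:R ^+ (p - 1)
  - p%:R * c%:R * (n%:R ^+ (p - 1) * n%:R^-1 ^+ (p - 1)) : R).
  by rewrite nV nE; ring.
by ring.
Qed.

(** The quotient p/(2k+1) for k < p, without a division by p.  The only
    multiple of p among these 2k+1 is p itself, which need not be a unit
    of R. *)
Definition odd_quotient (k : nat) : R :=
  if (2 * k + 1 == p)%N then 1 else p%:R / (2 * k + 1)%:R.

Lemma odd_quotientE (k : nat) : (k < p)%N ->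
  odd_quotient k * (2 * k + 1)%:R = p%:R.
Proof.
rewrite /odd_quotient; case: eqP => [->|kp klt]; first by rewrite mul1r.
rewrite divrK //; apply: coprime_unit; apply/dvdnP => -[c cE].
(* 2k+1 < 2p leaves only the multiples 0 and p. *)
by case: c cE => [|[|c]]; [lia | lia | nia].
Qed.

(** The two sides of the theorem agree modulo p^2 term by term, once the
    isolated term - p H_k a_k is put back into the sum at its index
    k = (p-1)/2.  Off that index [odd_quotient] supplies one factor p, so the
    binomial factors are needed modulo p only. *)
Lemma summand_mod_sqr (a : R) (k : nat) : (2 < p)%N -> (k < p)%N ->
  exists w,
    (4%:R^-1) ^+ (p - 1)
      * ('C(2 * p - 1, p - 1)%:R * ((-1) ^+ k * 'C(p - 1, k)%:R)
         * (odd_quotient k * a))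
    - ((4%:R^-1) ^+ (p - 1) * (odd_quotient k * a)
       - (if k == ((p - 1) %/ 2)%N
          then p%:R * (\sum_(1 <= i < k.+1) i%:R^-1) * a else 0))
    = p%:R ^+ 2 * w.
Proof.
move=> p2 kp.
have [b ->] := bin_double_prime_mod_sqr p2.
have [s ->] := sign_bin_prime_mod_sqr k kp.
have [q qE] := fermat_inv_mod_prime 4 (odd_prime_ndvd4 p p_pr p2).
have p_odd : odd p by case: (even_prime p_pr) => // pE; rewrite pE in p2.
rewrite /odd_quotient (_ : (2 * k + 1 == p)%N = (k == (p - 1) %/ 2)%N);
  last lia.
(* The witnesses below are the cofactors of e^2 when the difference is expanded
   with h = H_k and e = p. *)
move: (\sum_(_ <= _ < _) _) => h.
case: eqP => _.
  rewrite qE; set e := p%:R.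
  exists (a * (1 + e * q) * (s + b * (1 - e * h + e ^+ 2 * s)) - q * h * a).
  by ring.
move: (_ ^+ _) ((2 * k + 1)%:R^-1) => r d; set e := p%:R.
exists (r * d * a * (e * b * (1 - e * h + e ^+ 2 * s) - h + e * s)).
by ring.
Qed.

End PrimeUnits.

(** * Transfer to the p-adic numbers *)

Section PadicInt.
Variables (p : nat) (p_pr : prime p).

Lemma approx_natr (m n : nat) :
  approx (m%:R : padic_int p_pr) n = (m%:Z %% p%:Z ^+ n)%Z.
Proof.
elim: m => [|m IHm]; first by rewrite mulr0n.
by rewrite -addn1 natrD PoszD /= IHm modzDml modzDmr.
Qed.

Lemma padic_natr_unit (m : nat) :
  ~~ (p %| m)%N -> (m%:R : padic_int p_pr) \is a GRing.unit.
Proof.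
by move=> pm; rewrite unfold_in /= /padic_unit approx_natr expr1 modz_nat.
Qed.

Lemma padic_pchar0 : [pchar (padic p_pr)] =i pred0.
Proof.
apply/pcharf0P => n; rewrite -(rmorph_nat (@FracField.tofrac _)) tofrac_eq0.
case: n => [|n]; first by rewrite mulr0n !eqxx.
(* Already the residue modulo p^(n+1) > n+1 separates n+1 from 0. *)
apply: (introF eqP) => /(congr1 (fun x : padic_int p_pr => approx x n.+1)).
rewrite approx_natr /= mod0z -[p%:Z]natz -natrX natz modz_nat modn_small //.
by apply: ltn_expl; apply: prime_gt1.
Qed.

End PadicInt.

Theorem theorem1p3 (p : nat) (p_pr : prime p) (p_gt3 : (3 < p)%N)
    (a : nat -> padic_int p_pr) :
  padic_congr 2
    (\sum_(0 <= k < p)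
       'C(2 * k, k)%:R * (dual_seq a k)%:F / 4%:R ^+ k)
    (p%:R / 4%:R ^+ (p - 1)
       * (\sum_(0 <= k < p) (a k)%:F / (2 * k + 1)%:R)
     - p%:R * harmonic_number (padic p_pr) ((p - 1) %/ 2)
       * (a ((p - 1) %/ 2)%N)%:F).
Proof.
pose R := padic_int p_pr.
have unitR : forall n, ~~ (p %| n)%N -> (n%:R : R) \is a GRing.unit.
  exact: padic_natr_unit.
have u4 : (4%:R : R) \is a GRing.unit.
  by apply: unitR; exact: odd_prime_ndvd4 (ltnW p_gt3).
have char0 := padic_pchar0 p p_pr.
have oqF k : (k < p)%N ->
    (odd_quotient R p k)%:F = p%:R / (2 * k + 1)%:R :> padic p_pr.
  move=> kp; have k0 : (2 * k + 1)%:R != 0 :> padic p_pr.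
    by move/pcharf0P: char0 => ->; rewrite addn1.
  apply: (mulIf k0); rewrite divfK //.
  rewrite -(rmorph_nat (@FracField.tofrac R)) -rmorphM.
  by rewrite odd_quotientE ?rmorph_nat.
pose q : R := (4%:R^-1) ^+ (p - 1).
have qF : q%:F = (4%:R^-1) ^+ (p - 1) :> padic p_pr.
  by rewrite rmorphXn /= rmorphV // rmorph_nat.
set m := ((p - 1) %/ 2)%N.
pose h : R := \sum_(1 <= i < m.+1) i%:R^-1.
have mp : (m < p)%N by rewrite /m; lia.
have hF : h%:F = harmonic_number (padic p_pr) m.
  rewrite rmorph_sum; apply: eq_big_nat => i /andP[i0 im].
  by rewrite /= rmorphV ?rmorph_nat //; apply: unitR; rewrite gtnNdvd //; lia.
pose T k : R := 'C(2 * p - 1, p - 1)%:R * ((-1) ^+ k * 'C(p - 1, k)%:R)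
         * (odd_quotient R p k * a k).
(* Both sides lie in Z_p because each p/(2k+1) does. *)
exists (q * \sum_(0 <= k < p) T k),
  (q * (\sum_(0 <= k < p) odd_quotient R p k * a k) - p%:R * h * a m).
suff [w wE] : exists w, q * (\sum_(0 <= k < p) T k)
    - (q * (\sum_(0 <= k < p) odd_quotient R p k * a k) - p%:R * h * a m)
    = p%:R ^+ 2 * w.
  exists w; split=> //.
    rewrite rmorphM /= qF rmorph_sum /=.
    transitivity (\sum_(0 <= k < p) 'C(2 * k, k)%:R
       * dual_seq (fun j => (a j)%:F) k / 4%:R ^+ k : padic p_pr).
      apply: eq_bigr => k _; congr (_ * _ / _); rewrite rmorph_sum.
      by apply: eq_bigr => j _; rewrite /= !rmorphM rmorphXn rmorphN1 rmorph_nat.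
    rewrite sum_central_bin_dual ?prime_gt0 //; congr (_ * _).
    apply: eq_big_nat => k /andP[_ kp].
    by rewrite !rmorphM /= oqF // rmorphXn rmorphN1 !rmorph_nat.
  rewrite rmorphB !rmorphM /= qF hF rmorph_nat rmorph_sum /=.
  congr (_ - _); rewrite mulrAC mulrC exprVn; congr (_ * _).
  rewrite mulr_sumr; apply: eq_big_nat => k /andP[_ kp].
  by rewrite rmorphM /= oqF //; ring.
have -> : p%:R * h * a m = \sum_(0 <= k < p) (if k == m then
    p%:R * (\sum_(1 <= i < k.+1) i%:R^-1) * a k else 0).
  by rewrite -big_mkcond big_nat1_eq mp.
rewrite !mulr_sumr -!sumrB big_nat.
elim/big_rec: _ => [|k x /andP[_ kp] [w ->]]; first by exists 0; rewrite mulr0.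
have [v ->] := summand_mod_sqr R p p_pr unitR (a k) k (ltnW p_gt3) kp.
by exists (v + w); rewrite mulrDr.
Qed.
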